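(* Let $X$ be a finite digital image, $Y$ a digital image, and let $f:X\to Y$ be a strong homotopy equivalence. Then $f_*:H_q(X)\to H_q(Y)$ is an isomorphism for each $q\ge 0$.
   Context: A digital image is a set $X$ together with a symmetric, antireflexive adjacency relation (equivalently, a simple graph). Write $x\leftrightarrow x'$ for ''adjacent'' and $x\mathrel{\underline{\leftrightarrow}} x'$ for ''adjacent or equal''. A function $f:X\to Y$ between digital images is continuous if $x\leftrightarrow x'$ implies $f(x)\mathrel{\underline{\leftrightarrow}} f(x')$. For integers $a\le b$, $[a,b]_{\mathbb Z}=\{a,\dots,b\}$, where $s,t$ are adjacent iff $|s-t|=1$. Strong homotopy: the $\mathrm{NP}_2$ adjacency on $X\times[0,k]_{\mathbb Z}$ makes two distinct points $(x,t),(x',t')$ adjacent iff $x\mathrel{\underline{\leftrightarrow}} x'$ and $t\mathrel{\underline{\leftrightarrow}} t'$. Continuous $f,g:X\to Y$ are strongly homotopic, written $f\cong g$, if for some positive integer $k$ there is $H:X\times[0,k]_{\mathbb Z}\to Y$ with $H(x,0)=f(x)$, $H(x,k)=g(x)$ for all $x$, continuous with respect to the $\mathrm{NP}_2$ adjacency on the domain. A continuous $f:X\to Y$ is a strong homotopy equivalence if there is a continuous $g:Y\to X$ with $f\circ g\cong\mathrm{id}_Y$ and $g\circ f\cong\mathrm{id}_X$. Digital homology (the simplicial homology of the clique complex): a $q$-simplex of $X$ is a set of $q+1$ mutually adjacent points, written $\langle x_0,\dots,x_q\rangle$. The chain group $C_q(X)$ is the free abelian group generated by the $q$-simplices, with the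 identification $\langle x_0,\dots,x_q\rangle=(-1)^\rho\langle x_{\rho(0)},\dots,x_{\rho(q)}\rangle$ for permutations $\rho$, where $(-1)^\rho$ is the sign of $\rho$. The boundary $\partial_q:C_q(X)\to C_{q-1}(X)$ is given by $\partial_q\langle x_0,\dots,x_q\rangle=\sum_{i=0}^q(-1)^i\langle x_0,\dots,\widehat{x_i},\dots,x_q\rangle$ (with $\partial_0=0$). Put $Z_q(X)=\ker\partial_q$, $B_q(X)=\operatorname{im}\partial_{q+1}$, $H_q(X)=Z_q(X)/B_q(X)$. A continuous $f:X\to Y$ induces $f_\#:C_q(X)\to C_q(Y)$, $f_\#\langle x_0,\dots,x_q\rangle=\langle f(x_0),\dots,f(x_q)\rangle$, interpreted as $0$ if the points $f(x_0),\dots,f(x_q)$ are not all distinct, and hence a homomorphism $f_*:H_q(X)\to H_q(Y)$. *)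

(* Defs.v *)
From HB Require Import structures.
From mathcomp Require Import freeg.
From mathcomp Require Import all_boot all_order perm all_algebra.
From mathcomp Require Import zify.
From mathcomp Require Import boolp classical_sets cardinality.

Set Implicit Arguments.
Unset Strict Implicit.
Unset Printing Implicit Defensive.

Import GRing.Theory Num.Theory.

Local Open Scope ring_scope.
Local Open Scope quotient_scope.

(* Under the axioms of boolp every type is a choiceType and every proposition
   is decidable, so that a choiceType with a boolean relation is no
   restriction on the underlying set or its adjacency. *)
Record digital_image := DigitalImage {
  point :> choiceType;
  adj : rel point;
  adj_sym : symmetric adj;
  adj_irr : irreflexive adj }.

Definition adj_eq (X : digital_image) (x y : X) : bool := (x == y) || adj x y.

Definition dcontinuous (X Y : digital_image) (f : X -> Y) : Prop :=
  forall x x' : X, adj x x' -> adj_eq (f x) (f x').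

Record dmap (X Y : digital_image) := DMap {
  dfun :> X -> Y;
  dfun_continuous : dcontinuous dfun }.

Section Interval.
Variable k : nat.

Definition interval_adj (s t : 'I_k.+1) : bool := `|s%:Z - t%:Z| == 1.

Lemma interval_adj_sym : symmetric interval_adj.
Proof. by move=> s t; rewrite /interval_adj distrC. Qed.

Lemma interval_adj_irr : irreflexive interval_adj.
Proof. by move=> s; rewrite /interval_adj subrr normr0. Qed.

(* [0, k]_Z *)
Definition interval : digital_image :=
  DigitalImage interval_adj_sym interval_adj_irr.

End Interval.

Section NP2.
Variables X Y : digital_image.

Definition NP2_adj (p q : X * Y) : bool :=
  [&& p != q, adj_eq p.1 q.1 & adj_eq p.2 q.2].

Lemma NP2_adj_sym : symmetric NP2_adj.
Proof.
by move=> p q; rewrite /NP2_adj /adj_eq !(eq_sym q, eq_sym q.1, eq_sym q.2)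
  !(adj_sym q.1, adj_sym q.2).
Qed.

Lemma NP2_adj_irr : irreflexive NP2_adj.
Proof. by move=> p; rewrite /NP2_adj eqxx. Qed.

Definition NP2 : digital_image := DigitalImage NP2_adj_sym NP2_adj_irr.

End NP2.

Definition strongly_homotopic (X Y : digital_image) (f g : X -> Y) : Prop :=
  exists k : nat, (0 < k)%N /\
  exists H : NP2 X (interval k) -> Y,
    [/\ dcontinuous H,
        forall x : X, H (x, ord0) = f x &
        forall x : X, H (x, ord_max) = g x].

Definition strong_homotopy_equivalence (X Y : digital_image) (f : dmap X Y) :
  Prop :=
  exists g : dmap Y X,
    strongly_homotopic (f \o g) id /\ strongly_homotopic (g \o f) id.

Section Span.
Variables (V : zmodType) (P : V -> Prop).

(* the subgroup generated by P, as the intersection of all subgroups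
   containing P *)
Definition span : {pred V} := fun x =>
  `[< forall S : {pred V}, zmod_closed S -> (forall y, P y -> y \in S) ->
      x \in S >].

Lemma span_zmod_closed : zmod_closed span.
Proof.
split=> [|x y /asboolP hx /asboolP hy]; apply/asboolP => S hS PS.
  by case: hS.
by case: (hS) => _; apply; [exact: hx | exact: hy].
Qed.

HB.instance Definition _ := GRing.isZmodClosed.Build V span span_zmod_closed.

Lemma span_gen x : P x -> x \in span.
Proof. by move=> Px; apply/asboolP => S _; apply. Qed.

Lemma span_ker (W : zmodType) (phi : {additive V -> W}) :
  (forall x, P x -> phi x = 0) -> forall x, x \in span -> phi x = 0.
Proof.
move=> phiP x /asboolP /(_ [pred x | phi x == 0]) /= h; apply/eqP/h.
  split=> [|y z]; rewrite !inE ?raddf0 // raddfB.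
  by move=> /eqP -> /eqP ->; rewrite subrr.
by move=> y Py; rewrite inE phiP.
Qed.

End Span.

(* The homomorphism V/I -> W induced by a homomorphism V -> W that vanishes
   on I. *)
Definition quot_lift (V W : zmodType) (I : zmodClosed V)
    (phi : {additive V -> W}) (phiI : forall x, x \in I -> phi x = 0)
    (x : Quotient.quot I) : W :=
  phi (repr x).

Section QuotientMap.
Variables (V W : zmodType) (I : zmodClosed V) (phi : {additive V -> W}).
Hypothesis phiI : forall x, x \in I -> phi x = 0.

Lemma quot_liftE (x : V) : quot_lift phiI (\pi_(Quotient.quot I) x) = phi x.
Proof.
rewrite /quot_lift; apply/eqP; rewrite -subr_eq0 -raddfB; apply/eqP/phiI.
by rewrite Quotient.idealrBE reprK.
Qed.

Lemma quot_lift_additive : zmod_morphism (quot_lift phiI).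
Proof.
move=> x y; rewrite -[x]reprK -[y]reprK -raddfB.
by rewrite !quot_liftE raddfB.
Qed.

HB.instance Definition _ :=
  GRing.isZmodMorphism.Build (Quotient.quot I) W (quot_lift phiI)
    quot_lift_additive.

End QuotientMap.

Section FreeLift.
Variables (K : choiceType) (W : zmodType) (f : K -> W).

(* ssrint.zmodule W is W seen as a module over int *)
Definition free_lift (c : {freeg K}) : W :=
  fglift (f : K -> ssrint.zmodule W) c.

Lemma free_lift_additive : zmod_morphism free_lift.
Proof. exact: (@lift_is_additive _ _ (ssrint.zmodule W) f). Qed.

HB.instance Definition _ :=
  GRing.isZmodMorphism.Build {freeg K} W free_lift free_lift_additive.

Lemma free_liftU (n : int) k : free_lift << n *g k >> = f k *~ n.
Proof. exact: (@liftU _ (ssrint.zmodule W) _ f). Qed.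

End FreeLift.

Definition mutually_adjacent (X : digital_image) (q : nat)
    (x : {ffun 'I_q.+1 -> X}) : bool :=
  [forall i, forall j, (i != j) ==> adj (x i) (x j)].

(* the q-simplices of X with an ordering of their vertices *)
Definition osimplex (X : digital_image) (q : nat) : Type :=
  {x : {ffun 'I_q.+1 -> X} | mutually_adjacent x}.

HB.instance Definition _ X q := Choice.on (osimplex X q).

Section Chains.
Variables (X : digital_image) (q : nat).
Implicit Types (x : {ffun 'I_q.+1 -> X}) (s t : osimplex X q).

Definition reorder x (rho : 'S_q.+1) : {ffun 'I_q.+1 -> X} :=
  [ffun i => x (rho i)].

(* s is identified with (-1)^rho t whenever t lists the vertices of s in the
   order given by rho *)
Definition relator (c : {freeg (osimplex X q)}) : Prop :=
  exists s t (rho : 'S_q.+1),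
    val t = reorder (val s) rho /\ c = << s >> - << (-1) ^+ rho *g t >>.

Definition chain : zmodType := Quotient.quot (span relator).

(* <x_0, ..., x_q>; the value 0 when the x_i do not form a simplex only makes
   the function total *)
Definition bracket x : chain :=
  if insub x is Some s then \pi_chain << s : osimplex X q >> else 0.

Lemma mutually_adjacent_reorder x (rho : 'S_q.+1) :
  mutually_adjacent (reorder x rho) = mutually_adjacent x.
Proof.
apply/forallP/forallP => h i; apply/forallP => j; apply/implyP => ij.
  have /forallP/(_ ((rho^-1)%g j)) := h ((rho^-1)%g i).
  by rewrite !ffunE !permKV (inj_eq perm_inj) => /implyP; apply.
have /forallP/(_ (rho j)) := h (rho i).
by rewrite !ffunE (inj_eq perm_inj) => /implyP; apply.
Qed.

Lemma bracket_val s : bracket (val s) = \pi_chain << s >>.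
Proof. by rewrite /bracket valK. Qed.

Lemma bracket0 x : ~~ mutually_adjacent x -> bracket x = 0.
Proof. by move=> nx; rewrite /bracket insubN. Qed.

Lemma bracket_reorder x (rho : 'S_q.+1) :
  bracket x = bracket (reorder x rho) *~ (-1) ^+ rho.
Proof.
have [ax|nx] := boolP (mutually_adjacent x); last first.
  by rewrite !bracket0 ?mutually_adjacent_reorder ?mul0rz.
have ay : mutually_adjacent (reorder x rho).
  by rewrite mutually_adjacent_reorder.
rewrite -[x](SubK (osimplex X q) ax).
rewrite -[reorder _ _](SubK (osimplex X q) ay) !bracket_val -raddfMz.
have -> n (k : osimplex X q) : << k >> *~ n = << n *g k >>.
  apply/eqP/freeg_eqP => z; rewrite raddfMz /= !coeffU mul1r.
  by rewrite -mulrzl intz.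
apply/eqP; rewrite -Quotient.idealrBE; apply: span_gen.
by do 3!eexists; split; last by [].
Qed.

End Chains.

Section ChainLift.
Variables (X : digital_image) (q : nat) (W : zmodType).
Variable f : osimplex X q -> W.

Definition alternating : Prop :=
  forall s t (rho : 'S_q.+1),
    val t = reorder (val s) rho -> f s = f t *~ (-1) ^+ rho.

Hypothesis falt : alternating.

Lemma free_lift_relator c : c \in span (@relator X q) -> free_lift f c = 0.
Proof.
apply: span_ker => {}c [s [t [rho [tE ->]]]].
by rewrite raddfB /= !free_liftU -(falt tE) mulr1z subrr.
Qed.

(* the homomorphism with <s> |-> f s *)
Definition chain_lift : {additive chain X q -> W} :=
  quot_lift free_lift_relator.

Lemma chain_liftE s : chain_lift (bracket (val s)) = f s.
Proof.
rewrite bracket_val [LHS](quot_liftE free_lift_relator).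
by rewrite [LHS]free_liftU mulr1z.
Qed.

End ChainLift.

Lemma chain_eq (X : digital_image) (q : nat) (W : zmodType)
    (phi psi : {additive chain X q -> W}) :
  (forall s : osimplex X q, phi (bracket (val s)) = psi (bracket (val s))) ->
  phi =1 psi.
Proof.
move=> h c; rewrite -[c]reprK; move: (repr c) => {c} c.
rewrite -[c]freeg_sumE !raddf_sum; apply: eq_bigr => s _.
have -> : << coeff s c *g s >> = << s >> *~ coeff s c.
  apply/eqP/freeg_eqP => z; rewrite raddfMz /= !coeffU mul1r.
  by rewrite -mulrzl intz.
by rewrite !raddfMz; congr (_ *~ _); have := h s; rewrite bracket_val.
Qed.

Section Boundary.
Variable X : digital_image.

Definition face q (i : 'I_q.+2) (x : {ffun 'I_q.+2 -> X}) :
  {ffun 'I_q.+1 -> X} := [ffun j => x (lift i j)].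

Definition simplex_boundary q (x : {ffun 'I_q.+2 -> X}) : chain X q :=
  \sum_(i < q.+2) bracket (face i x) *~ (-1) ^+ i.

Lemma face_reorder q (i j : 'I_q.+2) (x : {ffun 'I_q.+2 -> X})
    (rho : 'S_q.+2) : rho i = j ->
  exists2 sigma : 'S_q.+1,
    rho = (odd i (+) odd j (+) sigma) :> bool &
    face i (reorder x rho) = reorder (face j x) sigma.
Proof.
move=> <-.
pose f k := odflt ord0 (unlift (rho i) (rho (lift i k))).
have fE k : lift (rho i) (f k) = rho (lift i k).
  rewrite /f; case: unliftP => [m ->//|/perm_inj/eqP].
  by rewrite eq_sym (negPf (neq_lift _ _)).
have finj : injective f.
  move=> k l /(congr1 (lift (rho i))); rewrite !fE => /perm_inj.
  exact: lift_inj.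
exists (perm finj).
  rewrite -odd_lift_perm; congr (odd_perm _); apply/permP => k.
  case: (unliftP i k) => [l|] ->; last by rewrite lift_perm_id.
  by rewrite lift_perm_lift permE fE.
by apply/ffunP => k; rewrite !ffunE permE fE.
Qed.

Lemma sign_shift (i j : nat) (b : bool) :
  (-1) ^+ (odd i (+) odd j (+) b) * (-1) ^+ i = (-1) ^+ j * (-1) ^+ b :> int.
Proof. by rewrite !signr_addb !signr_odd mulrC !mulrA -expr2 sqrr_sign mul1r. Qed.

Lemma sign_cancel (i j : nat) (b : bool) :
  odd i (+) odd j (+) b -> (-1) ^+ i + (-1) ^+ b * (-1) ^+ j = 0 :> int.
Proof.
rewrite -(signr_odd _ i) -(signr_odd _ j) -signr_addb.
by case: (odd i); case: (odd j); case: b.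
Qed.

Lemma simplex_boundary_alternating q :
  alternating (fun s : osimplex X q.+1 => simplex_boundary (val s)).
Proof.
move=> s t rho tE; rewrite tE /simplex_boundary mulrz_suml.
rewrite [LHS](reindex_inj (@perm_inj _ rho)) /=; apply: eq_bigr => i _.
have [sigma rhoE ->] := face_reorder (val s) (erefl (rho i)).
rewrite (bracket_reorder (face (rho i) (val s)) sigma) -!mulrzA rhoE.
congr (_ *~ _); rewrite [LHS]mulrC [RHS]mulrC; exact/esym/sign_shift.
Qed.

Definition boundaryS q : {additive chain X q.+1 -> chain X q} :=
  chain_lift (@simplex_boundary_alternating q).

(* d_0 = 0; since 0.-1 = 0, its target is C_0 in place of C_{-1} *)
Definition boundary q : chain X q -> chain X q.-1 :=
  match q with
  | 0 => fun=> 0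
  | p.+1 => boundaryS p
  end.

Lemma boundary_additive q : zmod_morphism (@boundary q).
Proof. by case: q => [|q] c d; [rewrite /= subrr | exact: raddfB]. Qed.

HB.instance Definition _ q :=
  GRing.isZmodMorphism.Build (chain X q) (chain X q.-1) (@boundary q)
    (@boundary_additive q).

Lemma boundaryE q (s : osimplex X q.+1) :
  boundary (bracket (val s)) = simplex_boundary (val s).
Proof. exact: chain_liftE. Qed.

Lemma mutually_adjacent_face q (i : 'I_q.+2)
    (x : {ffun 'I_q.+2 -> X}) :
  mutually_adjacent x -> mutually_adjacent (face i x).
Proof.
move=> /forallP h; apply/forallP => j; apply/forallP => k; apply/implyP => jk.
have /forallP/(_ (lift i k)) := h (lift i j).
by rewrite !ffunE (inj_eq (@lift_inj _ i)) jk.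
Qed.

Lemma boundary_boundary q (c : chain X q.+1) : boundary (boundary c) = 0.
Proof.
case: q c => [//|q] c.
pose phi : {additive chain X q.+2 -> chain X q} :=
  (@boundary q.+1 : {additive _ -> _}) \o (@boundary q.+2 : {additive _ -> _}).
suff : phi =1 (\0 : {additive chain X q.+2 -> chain X q}) by apply.
apply: chain_eq => s.
suff : boundary (boundary (bracket (val s))) = 0 by [].
rewrite boundaryE /simplex_boundary raddf_sum.
pose h (p : 'I_q.+3 * 'I_q.+2) : 'I_q.+3 * 'I_q.+2 :=
  (lift p.1 p.2, inord (unbump p.2 p.1)).
pose F (p : 'I_q.+3 * 'I_q.+2) :=
  bracket (face p.2 (face p.1 (val s))) *~ ((-1) ^+ p.2 * (-1) ^+ p.1).
rewrite (eq_bigr (fun i => \sum_j F (i, j))) => [|i _]; last first.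
  have fs := mutually_adjacent_face i (valP s).
  rewrite raddfMz -[face i (val s)](SubK (osimplex X q.+1) fs).
  rewrite [X in X *~ _]boundaryE.
  by rewrite mulrz_suml; apply: eq_bigr => j _; rewrite -mulrzA SubK.
rewrite pair_big /= (eq_bigr F) => [|[]//].
have hval p : (h p).2 = unbump p.2 p.1 :> nat.
  rewrite inordK //; case: p => i j /=; rewrite /unbump; have := ltn_ord i.
  have := ltn_ord j; case: ltnP; lia.
have hK : involutive h.
  move=> p; have h1 : (h (h p)).1 = p.1.
    by apply/val_inj; rewrite /= hval /bump /unbump; lia.
  have h2 : (h (h p)).2 = p.2.
    by apply/val_inj; rewrite [LHS]hval hval /= /bump /unbump; lia.
  by rewrite [LHS]surjective_pairing h1 h2 -surjective_pairing.
rewrite (bigID (fun p : 'I_q.+3 * 'I_q.+2 => (p.2 < p.1)%N)) /= [X in _ + X](reindex_inj (inv_inj hK)) /=.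
rewrite [X in _ + X](eq_bigl (fun p : 'I_q.+3 * 'I_q.+2 => (p.2 < p.1)%N)); last first.
  move=> p; rewrite hval /= /bump /unbump; lia.
rewrite -big_split big1 // => p ji /=; rewrite /F.
have -> : face (h p).2 (face (h p).1 (val s)) = face p.2 (face p.1 (val s)).
  apply/ffunP => k; rewrite !ffunE; congr (val s _); apply: val_inj => /=.
  by rewrite hval [RHS]bumpC.
rewrite -mulrzDr -!exprD hval /= /bump /unbump ji leqNgt ji add0n subn1.
case: (nat_of_ord p.1) ji => // n _.
by rewrite addnS exprS mulN1r addnC addNr mulr0z.
Qed.

End Boundary.

Section Homology.
Variables (X : digital_image) (q : nat).

Definition cycles : {pred chain X q} := fun c => boundary c == 0.

Lemma cycles_zmod_closed : zmod_closed cycles.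
Proof.
split=> [|c d /eqP c0 /eqP d0]; apply/eqP; first exact: raddf0.
by rewrite [LHS](boundary_additive c d) c0 d0 subrr.
Qed.

HB.instance Definition _ :=
  GRing.isZmodClosed.Build (chain X q) cycles cycles_zmod_closed.

(* Z_q(X) as a group *)
Record cycle := Cycle { cycle_val : chain X q; _ : cycle_val \in cycles }.

HB.instance Definition _ := [isSub for cycle_val].
HB.instance Definition _ := [Choice of cycle by <:].
HB.instance Definition _ := [SubChoice_isSubZmodule of cycle by <:].

(* B_q(X) as a subgroup of Z_q(X) *)
Definition boundaries : {pred cycle} := fun z =>
  `[< exists b : chain X q.+1, boundary b = val z >].

Lemma boundaries_zmod_closed : zmod_closed boundaries.
Proof.
split=> [|z w /asboolP[b bz] /asboolP[c cw]]; apply/asboolP.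
  by exists 0; exact: raddf0.
by exists (b - c); rewrite [LHS](boundary_additive b c) bz cw.
Qed.

HB.instance Definition _ :=
  GRing.isZmodClosed.Build cycle boundaries boundaries_zmod_closed.

Definition homology : zmodType := Quotient.quot boundaries.

End Homology.

Section InducedMap.
Variables (X Y : digital_image) (f : dmap X Y).

Definition image_simplex q (x : {ffun 'I_q.+1 -> X}) : {ffun 'I_q.+1 -> Y} :=
  [ffun i => f (x i)].

Definition simplex_map q (x : {ffun 'I_q.+1 -> X}) : chain Y q :=
  if injectiveb (image_simplex x) then bracket (image_simplex x) else 0.

Lemma simplex_mapE q (s : osimplex X q) :
  simplex_map (val s) = bracket (image_simplex (val s)).
Proof.
rewrite /simplex_map; case: ifPn => // ninj; rewrite bracket0 //.
apply: contraNN ninj => /forallP h; apply/injectiveP => i j eij.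
apply/eqP; apply: contraT => ij; have /forallP/(_ j) := h i.
by rewrite ij eij adj_irr.
Qed.

Lemma simplex_map_alternating q :
  alternating (fun s : osimplex X q => simplex_map (val s)).
Proof.
move=> s t rho tE; rewrite !simplex_mapE (bracket_reorder _ rho) tE.
by congr (bracket _ *~ _); apply/ffunP => i; rewrite !ffunE.
Qed.

(* f_# : <x_0, ..., x_q> |-> <f(x_0), ..., f(x_q)> *)
Definition chain_map q : {additive chain X q -> chain Y q} :=
  chain_lift (@simplex_map_alternating q).

Lemma chain_mapE q (s : osimplex X q) :
  chain_map q (bracket (val s)) = simplex_map (val s).
Proof. exact: chain_liftE. Qed.

Lemma image_simplex_adjacent q (s : osimplex X q) :
  injective (image_simplex (val s)) -> mutually_adjacent (image_simplex (val s)).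
Proof.
move=> inj; apply/forallP => i; apply/forallP => j; apply/implyP => ij.
have /forallP/(_ i)/forallP/(_ j) := valP s; rewrite ij /= => aij.
have := dfun_continuous f aij; rewrite !ffunE /adj_eq => /orP[|//].
by move=> /eqP e; rewrite (inj i j) ?eqxx // !ffunE in ij.
Qed.

Lemma simplex_boundary_collapse (Z : digital_image) q
    (x : {ffun 'I_q.+2 -> Z}) :
  ~~ injectiveb x -> simplex_boundary x = 0.
Proof.
move=> /injectivePn[a [b ab xab]]; rewrite /simplex_boundary.
rewrite (bigD1 a) //= (bigD1 b) 1?eq_sym //= big1 ?addr0.
  have [|sigma sgn] := @face_reorder Z q a b x (tperm a b); first exact: tpermL.
  have -> : reorder x (tperm a b) = x.
    by apply/ffunP => i; rewrite ffunE; case: tpermP => [->|->|].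
  move=> ->; rewrite (bracket_reorder (face b x) sigma) -mulrzA -mulrzDr.
  by rewrite sign_cancel ?mulr0z // -sgn odd_tperm.
move=> i /andP[ia ib]; rewrite bracket0 ?mul0rz //.
apply/negP => /forallP.
case: (unliftP i a) ia ab xab => [a' ->|->]; last by rewrite eqxx.
case: (unliftP i b) ib => [b' ->|->]; last by rewrite eqxx.
move=> _ _; rewrite (inj_eq (@lift_inj _ i)) => ab xab.
by move=> /(_ a')/forallP/(_ b'); rewrite !ffunE ab xab adj_irr.
Qed.

Lemma chain_map_boundaryS q (c : chain X q.+1) :
  boundary (chain_map q.+1 c) = chain_map q (boundary c).
Proof.
pose phi : {additive chain X q.+1 -> chain Y q} :=
  (@boundary Y q.+1 : {additive _ -> _}) \o chain_map q.+1.
pose psi : {additive chain X q.+1 -> chain Y q} :=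
  chain_map q \o (@boundary X q.+1 : {additive _ -> _}).
suff : phi =1 psi by apply.
apply: chain_eq => s.
suff : boundary (chain_map q.+1 (bracket (val s))) =
  chain_map q (boundary (bracket (val s))) by [].
rewrite boundaryE chain_mapE simplex_mapE.
have -> : chain_map q (simplex_boundary (val s)) =
    simplex_boundary (image_simplex (val s)).
  rewrite /simplex_boundary raddf_sum; apply: eq_bigr => i _.
  rewrite raddfMz; congr (_ *~ _).
  have fs := mutually_adjacent_face i (valP s).
  rewrite -[face i (val s)](SubK (osimplex X q) fs) chain_mapE simplex_mapE.
  by congr bracket; apply/ffunP => j; rewrite !ffunE.
have [inj|ninj] := boolP (injectiveb (image_simplex (val s))).
  have /image_simplex_adjacent h := elimT (injectiveP _) inj.
  by rewrite -[image_simplex _](SubK (osimplex Y q.+1) h) boundaryE.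
rewrite simplex_boundary_collapse // bracket0 ?raddf0 //.
apply: contraNN ninj => /forallP h; apply/injectiveP => i j eij.
apply/eqP; apply: contraT => ij; have /forallP/(_ j) := h i.
by rewrite ij eij adj_irr.
Qed.

Lemma chain_map_boundary q (c : chain X q) :
  boundary (chain_map q c) = chain_map q.-1 (boundary c).
Proof. by case: q c => [|q] c; [rewrite raddf0 | exact: chain_map_boundaryS]. Qed.

Lemma chain_map_cycle q (z : cycle X q) : chain_map q (cycle_val z) \in @cycles Y q.
Proof.
case: z => c /= /eqP cz; apply/eqP.
by rewrite chain_map_boundary cz raddf0.
Qed.

Definition cycle_map q (z : cycle X q) : cycle Y q := Cycle (chain_map_cycle z).

Lemma cycle_map_additive q : zmod_morphism (@cycle_map q).
Proof. by move=> z w; apply/val_inj; exact: (raddfB (chain_map q)). Qed.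

HB.instance Definition _ q :=
  GRing.isZmodMorphism.Build (cycle X q) (cycle Y q) (@cycle_map q)
    (@cycle_map_additive q).

Definition cycle_class_map q : {additive cycle X q -> homology Y q} :=
  \pi_(homology Y q) \o @cycle_map q.

Lemma cycle_class_map_boundaries q (z : cycle X q) :
  z \in @boundaries X q -> cycle_class_map q z = 0.
Proof.
move=> /asboolP[b bz]; move: (raddf0 \pi_(homology Y q)) => <-.
apply/eqP; rewrite -Quotient.idealrBE subr0; apply/asboolP.
by exists (chain_map q.+1 b); rewrite chain_map_boundary; congr (chain_map q _).
Qed.

(* f_* : [z] |-> [f_# z] *)
Definition homology_map q : {additive homology X q -> homology Y q} :=
  quot_lift (@cycle_class_map_boundaries q).

End InducedMap.

(* Main.v *)
(* If f and g differ at a single point a, and g(a) is adjacent or equal to f(x)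
   whenever x is adjacent or equal to a, then D<x_0, ..., x_q> =
   <g(a), f(x_0), ..., f(x_q)> when a is one of the x_i, and 0 otherwise, is
   visibly alternating and is a chain homotopy from f_# to g_#. Two consecutive
   stages f, g of a strong homotopy satisfy the stronger condition that f(x) and
   g(x') are adjacent or equal whenever x and x' are, so that changing f into g
   on any set of points gives a continuous map. A chain has finite support, so
   the values of f can be changed one by one on its vertices; hence f_# and g_#
   agree on a cycle up to a boundary, even when the digital image is infinite. *)
Require Import Defs.
From mathcomp Require Import freeg.
From mathcomp Require Import all_boot perm all_algebra.
From mathcomp Require Import boolp classical_sets cardinality.

Set Implicit Arguments.
Unset Strict Implicit.
Unset Printing Implicit Defensive.

Import GRing.Theory Num.Theory.

Local Open Scope ring_scope.
Local Open Scope quotient_scope.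

(** * Adjacency of vertices, and boundaries of possibly degenerate tuples *)

Lemma adj_eq_refl (X : digital_image) (x : X) : adj_eq x x.
Proof. by rewrite /adj_eq eqxx. Qed.

Lemma adj_eq_sym (X : digital_image) : symmetric (@adj_eq X).
Proof. by move=> x y; rewrite /adj_eq eq_sym adj_sym. Qed.

Lemma dmap_adj_eq (X Y : digital_image) (f : dmap X Y) (x x' : X) :
  adj_eq x x' -> adj_eq (f x) (f x').
Proof.
by case/orP => [/eqP ->|xx']; [exact: adj_eq_refl | exact: dfun_continuous].
Qed.

Section SimplexAdjacency.
Variable X : digital_image.

Lemma osimplex_adj q (s : osimplex X q) i j :
  i != j -> adj (val s i) (val s j).
Proof. by have /forallP/(_ i)/forallP/(_ j)/implyP := valP s. Qed.

Lemma osimplex_adj_eq q (s : osimplex X q) i j :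
  adj_eq (val s i) (val s j).
Proof.
have [->|/(osimplex_adj s) h] := eqVneq i j; first exact: adj_eq_refl.
by rewrite /adj_eq h orbT.
Qed.

Lemma osimplex_inj q (s : osimplex X q) : injective (val s).
Proof.
move=> i j eij; apply/eqP; apply: contraT => /(osimplex_adj s).
by rewrite eij adj_irr.
Qed.

(** Such a tuple is a simplex or repeats a vertex. In the second case the bracket is 0 by default
    and the boundary sum cancels. Cones need this, since [g a] may equal some [f x] and [f] may
    merge vertices. *)
Lemma boundary_bracket q (x : {ffun 'I_q.+2 -> X}) :
  (forall i j, adj_eq (x i) (x j)) -> boundary (bracket x) = simplex_boundary x.
Proof.
move=> hx; have [/injectiveP inj|ninj] := boolP (injectiveb x).
  have ax : mutually_adjacent x.
    apply/forallP => i; apply/forallP => j; apply/implyP => ij.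
    by have := hx i j; rewrite /adj_eq (inj_eq inj) (negPf ij).
  by rewrite -[x](SubK (osimplex X q.+1) ax) boundaryE.
rewrite simplex_boundary_collapse // bracket0 ?raddf0 //.
apply: contraNN ninj => ax; apply/injectiveP.
by rewrite -[x](SubK (osimplex X q.+1) ax); exact: osimplex_inj.
Qed.

End SimplexAdjacency.

(** * Cones and their faces *)

Section Cone.
Variables (X : digital_image) (y : X).

Definition cone q (x : {ffun 'I_q.+1 -> X}) : {ffun 'I_q.+2 -> X} :=
  [ffun i => oapp x y (unlift ord0 i)].

Lemma cone0 q (x : {ffun 'I_q.+1 -> X}) : cone x ord0 = y.
Proof. by rewrite ffunE unlift_none. Qed.

Lemma cone_lift q (x : {ffun 'I_q.+1 -> X}) i : cone x (lift ord0 i) = x i.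
Proof. by rewrite ffunE liftK. Qed.

(** Extending [rho] by a fixed apex keeps its sign, which makes the prism operator alternating. *)
Lemma cone_reorder q (x : {ffun 'I_q.+1 -> X}) (rho : 'S_q.+1) :
  cone (reorder x rho) = reorder (cone x) (lift_perm ord0 ord0 rho).
Proof.
apply/ffunP => i; rewrite [RHS]ffunE.
case: (unliftP ord0 i) => [j|] ->.
  by rewrite lift_perm_lift !cone_lift ffunE.
by rewrite lift_perm_id !cone0.
Qed.

Lemma face_cone0 q (x : {ffun 'I_q.+1 -> X}) : face ord0 (cone x) = x.
Proof. by apply/ffunP => i; rewrite ffunE cone_lift. Qed.

Lemma face_cone_lift q i (x : {ffun 'I_q.+2 -> X}) :
  face (lift ord0 i) (cone x) = cone (face i x).
Proof.
apply/ffunP => j; rewrite ffunE; case: (unliftP ord0 j) => [k|] ->.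
  rewrite [RHS]cone_lift [RHS]ffunE -[RHS]cone_lift; congr (cone x _).
  by apply: val_inj; rewrite /= /bump /= !add1n ltnS addnS.
rewrite [RHS]cone0 -[RHS](cone0 x); congr (cone x _); exact: val_inj.
Qed.

Lemma simplex_boundary_cone q (x : {ffun 'I_q.+1 -> X}) :
  simplex_boundary (cone x) =
  bracket x -
  \sum_(i < q.+1) bracket (face (lift ord0 i) (cone x)) *~ (-1) ^+ i.
Proof.
rewrite /simplex_boundary big_ord_recl face_cone0 expr0 mulr1z; congr (_ + _).
rewrite -sumrN; apply: eq_bigr => i _.
by rewrite -mulrNz lift0 exprS mulN1r.
Qed.

(* The vertex x k, moved to the front of x, is replaced by y. *)
Lemma face_cone_reorder q k (x z : {ffun 'I_q.+1 -> X}) :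
  z k = y -> (forall i, i != k -> z i = x i) ->
  face (lift ord0 k) (cone x) = reorder z (lift_perm ord0 k 1).
Proof.
move=> zk zx; apply/ffunP => i; rewrite !ffunE.
case: (unliftP ord0 i) => [j|] ->.
  rewrite lift_perm_lift perm1 zx 1?eq_sym ?neq_lift //.
  have -> : lift (lift ord0 k) (lift ord0 j) = lift ord0 (lift k j).
    by apply: val_inj; rewrite /= /bump /= !add1n ltnS addnS.
  by rewrite liftK.
rewrite lift_perm_id zk.
have -> : lift (lift ord0 k) ord0 = ord0 by exact: val_inj.
by rewrite unlift_none.
Qed.

(** The cycle carrying the apex from the front to place [k] has sign [(-1) ^+ k], which cancels the
    sign of the face. *)
Lemma bracket_face_cone q (k : 'I_q.+1) (x z : {ffun 'I_q.+1 -> X}) :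
  z k = y -> (forall i, i != k -> z i = x i) ->
  bracket (face (lift ord0 k) (cone x)) *~ (-1) ^+ k = bracket z.
Proof.
move=> zk zx; rewrite (face_cone_reorder zk zx).
rewrite [RHS](bracket_reorder z (lift_perm ord0 k 1)).
by rewrite odd_lift_perm odd_perm1 addbF /= signr_odd.
Qed.

End Cone.

(** * The chain homotopy for a change at one point *)

Section OnePointHomotopy.
Variables (X Y : digital_image) (f g : dmap X Y) (a : X).
Hypothesis fg_off : forall x, x != a -> f x = g x.
Hypothesis fg_adj : forall x, adj_eq a x -> adj_eq (g a) (f x).

Definition simplex_homotopy q (x : {ffun 'I_q.+1 -> X}) : chain Y q.+1 :=
  if a \in codom x then bracket (cone (g a) (image_simplex f x)) else 0.

Lemma simplex_homotopy_alternating q :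
  alternating (fun s : osimplex X q => simplex_homotopy (val s)).
Proof.
move=> s t rho tE; rewrite tE /simplex_homotopy.
have -> : (a \in codom (reorder (val s) rho)) = (a \in codom (val s)).
  apply/codomP/codomP => -[i ->]; first by exists (rho i); rewrite ffunE.
  by exists ((rho^-1)%g i); rewrite ffunE permKV.
case: ifP => _; last by rewrite mul0rz.
have -> : image_simplex f (reorder (val s) rho) =
    reorder (image_simplex f (val s)) rho.
  by apply/ffunP => i; rewrite !ffunE.
rewrite cone_reorder (bracket_reorder _ (lift_perm ord0 ord0 rho)).
by rewrite odd_lift_perm.
Qed.

Definition homotopy q : {additive chain X q -> chain Y q.+1} :=
  chain_lift (@simplex_homotopy_alternating q).

Lemma homotopyE q (s : osimplex X q) :
  homotopy q (bracket (val s)) = simplex_homotopy (val s).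
Proof. exact: chain_liftE. Qed.

(** The face opposite the apex gives the [f] term; the face omitting [f a] has [g a] in its place
    and gives the [g] term. The other faces form the sum to be matched with the homotopy of the
    boundary. *)
Lemma boundary_simplex_homotopy q (s : osimplex X q) k : val s k = a ->
  boundary (simplex_homotopy (val s)) =
  simplex_map f (val s) - simplex_map g (val s) -
  \sum_(i < q.+1 | i != k)
     bracket (face (lift ord0 i) (cone (g a) (image_simplex f (val s))))
       *~ (-1) ^+ i.
Proof.
move=> sk; have as_ : a \in codom (val s) by apply/codomP; exists k.
rewrite /simplex_homotopy as_ !simplex_mapE boundary_bracket; last first.
  have ga i : adj_eq (g a) (image_simplex f (val s) i).
    by rewrite ffunE fg_adj // -sk osimplex_adj_eq.
  move=> i j; case: (unliftP ord0 i) => [i'|] ->; last first.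
    case: (unliftP ord0 j) => [j'|] ->; last exact: adj_eq_refl.
    by rewrite cone0 cone_lift.
  case: (unliftP ord0 j) => [j'|] ->; last first.
    by rewrite adj_eq_sym cone0 cone_lift.
  by rewrite !cone_lift !ffunE; apply/dmap_adj_eq/osimplex_adj_eq.
rewrite simplex_boundary_cone (bigD1 k) //= opprD addrA; congr (_ - _ - _).
apply: bracket_face_cone; first by rewrite ffunE sk.
move=> i ik; rewrite !ffunE fg_off //.
by rewrite -sk (inj_eq (@osimplex_inj _ _ s)).
Qed.

Lemma simplex_map_off q (x : {ffun 'I_q.+1 -> X}) :
  a \notin codom x -> simplex_map f x = simplex_map g x.
Proof.
move=> ax; rewrite /simplex_map.
suff -> : image_simplex f x = image_simplex g x by [].
apply/ffunP => i; rewrite !ffunE fg_off //.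
by apply: contraNneq ax => <-; exact: codom_f.
Qed.

(** Degree 0 is separate because there is no term from degree -1; a single vertex leaves the
    remaining sum empty. *)
Lemma boundary_homotopy0 (c : chain X 0) :
  boundary (homotopy 0 c) = chain_map f 0 c - chain_map g 0 c.
Proof.
(* Bundling both sides as additive maps reduces the identity to simplices. *)
pose phi : {additive chain X 0 -> chain Y 0} :=
  (@boundary Y 1 : {additive _ -> _}) \o homotopy 0.
pose psi : {additive chain X 0 -> chain Y 0} := chain_map f 0 \- chain_map g 0.
suff : phi =1 psi by apply.
apply: chain_eq => s.
suff : boundary (homotopy 0 (bracket (val s))) =
  chain_map f 0 (bracket (val s)) - chain_map g 0 (bracket (val s)) by [].
rewrite homotopyE !chain_mapE.
have [/codomP[k /esym sk]|ns] := boolP (a \in codom (val s)).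
  rewrite (boundary_simplex_homotopy sk) big_pred0 ?subr0 // => i.
  by rewrite !ord1 eqxx.
by rewrite simplex_map_off // subrr /simplex_homotopy (negPf ns) raddf0.
Qed.

Lemma boundary_homotopyS q (c : chain X q.+1) :
  boundary (homotopy q.+1 c) =
  chain_map f q.+1 c - chain_map g q.+1 c - homotopy q (boundary c).
Proof.
pose phi : {additive chain X q.+1 -> chain Y q.+1} :=
  (@boundary Y q.+2 : {additive _ -> _}) \o homotopy q.+1.
pose psi : {additive chain X q.+1 -> chain Y q.+1} :=
  (chain_map f q.+1 \- chain_map g q.+1) \-
  (homotopy q \o (@boundary X q.+1 : {additive _ -> _})).
suff : phi =1 psi by apply.
apply: chain_eq => s.
suff : boundary (homotopy q.+1 (bracket (val s))) =
  chain_map f q.+1 (bracket (val s)) - chain_map g q.+1 (bracket (val s)) -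
  homotopy q (boundary (bracket (val s))) by [].
rewrite homotopyE !chain_mapE boundaryE /simplex_boundary raddf_sum.
have faceE i : homotopy q (bracket (face i (val s)) *~ (-1) ^+ i) =
    simplex_homotopy (face i (val s)) *~ (-1) ^+ i.
  have fs := mutually_adjacent_face i (valP s).
  by rewrite raddfMz -[face i (val s)](SubK (osimplex X q) fs) homotopyE.
rewrite (eq_bigr _ (fun i _ => faceE i)).
have [/codomP[k /esym sk]|ns] := boolP (a \in codom (val s)).
  rewrite (boundary_simplex_homotopy sk); congr (_ - _).
  (* The face opposite [a] no longer contains [a], so its term is 0; every other face keeps [a], and
     its cone is a face of the cone. *)
  rewrite [RHS](bigD1 k) //= /simplex_homotopy ifN ?mul0rz ?add0r.
    apply: eq_bigr => i ik; rewrite ifT ?face_cone_lift.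
      by congr (bracket (cone _ _) *~ _); apply/ffunP => j; rewrite !ffunE.
    have [j kE|kE] := unliftP i k; last by rewrite kE eqxx in ik.
    by apply/codomP; exists j; rewrite ffunE -kE.
  apply/negP => /codomP[j]; rewrite ffunE -sk => /osimplex_inj/eqP.
  by rewrite (negPf (neq_lift _ _)).
rewrite simplex_map_off // subrr /simplex_homotopy (negPf ns) raddf0.
rewrite big1 ?subr0 // => i _; rewrite ifN ?mul0rz //.
by apply: contraNN ns => /codomP[j ->]; rewrite ffunE; exact: codom_f.
Qed.

End OnePointHomotopy.

(** * From one-point changes to strong homotopies *)

(** Weaker than a chain homotopy: [b] is chosen for each cycle, so the intermediate maps may depend
    on the support of [c]. *)
Definition homologous (X Y : digital_image) (f g : dmap X Y) : Prop :=
  forall q (c : chain X q), boundary c = 0 ->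
  exists b : chain Y q.+1, boundary b = chain_map f q c - chain_map g q c.

Section Homologous.
Variables X Y : digital_image.
Implicit Types f g h : dmap X Y.

Lemma homologous_refl f : homologous f f.
Proof. by move=> q c _; exists 0; rewrite raddf0 subrr. Qed.

Lemma homologous_trans f g h :
  homologous f g -> homologous g h -> homologous f h.
Proof.
move=> fg gh q c c0; have [b bE] := fg q c c0; have [b' b'E] := gh q c c0.
have bD : boundary (b + b') = boundary b + boundary b' by exact: raddfD.
by exists (b + b'); rewrite bD bE b'E addrA subrK.
Qed.

Lemma homologous_one_point f g a :
  (forall x, x != a -> f x = g x) ->
  (forall x, adj_eq a x -> adj_eq (g a) (f x)) -> homologous f g.
Proof.
move=> off fg [|q] c c0.
  by exists (homotopy f g a 0 c); exact: boundary_homotopy0.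
exists (homotopy f g a q.+1 c); rewrite boundary_homotopyS //.
by rewrite c0 raddf0 subr0.
Qed.

Lemma chain_finite_support q (c : chain X q) : exists r : seq X,
  forall f g, {in r, f =1 g} -> chain_map f q c = chain_map g q c.
Proof.
rewrite -[c]reprK; move: (repr c) => {c} c.
(* All vertices of the simplices in a free-group representative of the chain. *)
exists (flatten [seq codom (val (s : osimplex X q)) | s <- dom c]) => f g fg.
rewrite -[c]freeg_sumE !raddf_sum; apply: eq_big_seq => s sc.
have -> : << coeff s c *g s >> = << s >> *~ coeff s c.
  apply/eqP/freeg_eqP => z; rewrite raddfMz /= !coeffU mul1r.
  by rewrite -mulrzl intz.
rewrite !raddfMz; congr (_ *~ _).
suff : chain_map f q (bracket (val s)) = chain_map g q (bracket (val s)).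
  by rewrite bracket_val.
rewrite !chain_mapE !simplex_mapE; congr bracket.
apply/ffunP => i; rewrite !ffunE fg //; apply/flatten_mapP.
by exists s => //; exact: codom_f.
Qed.

Lemma chain_map_ext f g q : f =1 g -> chain_map f q =1 chain_map g q.
Proof. by move=> fg c; have [r rP] := chain_finite_support c; exact: rP. Qed.

Section OneStep.
Variables f g : dmap X Y.
Hypothesis fg : forall x x', adj_eq x x' -> adj_eq (f x) (g x').

Definition patch (r : seq X) (x : X) : Y := if x \in r then g x else f x.

Lemma patch_continuous r : dcontinuous (patch r).
Proof.
move=> x x' xx'; have {xx'}xx' : adj_eq x x' by rewrite /adj_eq xx' orbT.
rewrite /patch; case: ifP => _; case: ifP => _; try exact: dmap_adj_eq.
  by rewrite adj_eq_sym fg // adj_eq_sym.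
exact: fg.
Qed.

Definition patch_dmap r : dmap X Y := DMap (@patch_continuous r).

Lemma homologous_patch r : homologous f (patch_dmap r).
Proof.
elim: r => [|a r IHr].
  move=> q c _; exists 0; rewrite raddf0 (@chain_map_ext (patch_dmap [::]) f) //.
  by rewrite subrr.
apply: homologous_trans IHr _; apply: (homologous_one_point (a := a)) => x.
  by rewrite /= /patch inE => /negPf ->.
(* The old value at [x] is [g x], handled by continuity of [g], or [f x], handled by [fg]. *)
rewrite /= /patch inE eqxx /= => ax; case: ifP => _; first exact: dmap_adj_eq.
by rewrite adj_eq_sym fg // adj_eq_sym.
Qed.

(** Patching on the support of [c] already gives the same image chain as [g]. *)
Lemma homologous_step : homologous f g.
Proof.
move=> q c c0; have [r rP] := chain_finite_support c.
rewrite -(rP (patch_dmap r) g) => [|x xr]; first exact: homologous_patch.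
by rewrite /= /patch xr.
Qed.

End OneStep.

Lemma strongly_homotopic_homologous f g :
  strongly_homotopic f g -> homologous f g.
Proof.
case=> k [_ [H [Hcont H0 Hk]]].
(* The NP2 adjacency lets both coordinates move at once, which is exactly the hypothesis [fg] for
   consecutive stages. *)
have step (s t : Defs.interval k) x x' : adj_eq s t -> adj_eq x x' ->
    adj_eq (H (x, s)) (H (x', t)).
  move=> st xx'; have [[-> ->]|ne] := eqVneq (x, s) (x', t).
    exact: adj_eq_refl.
  by apply: Hcont; apply/and3P; split.
have stage_cont (t : 'I_k.+1) : dcontinuous (fun x => H (x, t)).
  move=> x x' xx'; apply: step; first exact: adj_eq_refl.
  by rewrite /adj_eq xx' orbT.
(* [inord] sends [t > k] to a default, so the induction carries the bound [t <= k]. *)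
pose stage t : dmap X Y := DMap (@stage_cont (inord t)).
suff main t : (t <= k)%N -> homologous f (stage t).
  move=> q c /(main k (leqnn k))[b bE]; exists b; rewrite bE.
  rewrite (@chain_map_ext (stage k) g) // => x /=.
  by rewrite -Hk; congr (H (x, _)); apply: val_inj; rewrite /= inordK.
elim: t => [_|t IHt tk].
  move=> q c _; exists 0; rewrite raddf0 (@chain_map_ext (stage 0) f) ?subrr //.
  move=> x /=; rewrite -H0; congr (H (x, _)); apply: val_inj.
  by rewrite /= inordK.
apply: homologous_trans (IHt (ltnW tk)) _; apply: homologous_step => x x' xx'.
apply: step => //; apply/orP; right; rewrite /= /interval_adj.
by rewrite !inordK ?ltnS ?(ltnW tk) // distrC intS addrK.
Qed.

End Homologous.

(** * Functoriality and passage to homology *)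

Definition dmap_id (X : digital_image) : dmap X X :=
  @DMap X X id (fun x x' xx' => introT orP (or_intror xx')).

Lemma comp_dcontinuous (X Y Z : digital_image) (f : dmap Y Z) (g : dmap X Y) :
  dcontinuous (f \o g).
Proof. by move=> x x' /(dfun_continuous g); exact: dmap_adj_eq. Qed.

Definition dmap_comp (X Y Z : digital_image) (f : dmap Y Z) (g : dmap X Y) :
  dmap X Z := DMap (comp_dcontinuous f g).

Lemma chain_map_id (X : digital_image) q : chain_map (dmap_id X) q =1 id.
Proof.
apply: (@chain_eq X q _ (chain_map (dmap_id X) q) idfun) => s.
rewrite chain_mapE simplex_mapE; congr bracket.
by apply/ffunP => i; rewrite ffunE.
Qed.

Lemma chain_map_comp (X Y Z : digital_image) (f : dmap Y Z) (g : dmap X Y) q :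
  chain_map (dmap_comp f g) q =1 chain_map f q \o chain_map g q.
Proof.
apply: (@chain_eq X q _ _ (chain_map f q \o chain_map g q)) => s.
rewrite [RHS](_ : _ = chain_map f q (simplex_map g (val s))); last first.
  by rewrite -chain_mapE.
rewrite chain_mapE simplex_mapE /simplex_map.
have imE : image_simplex (dmap_comp f g) (val s) =
    image_simplex f (image_simplex g (val s)).
  by apply/ffunP => i; rewrite !ffunE.
(* If [g] merges two vertices, so does the composite, and both sides are 0. *)
case: ifPn => [/injectiveP/image_simplex_adjacent gs|/injectivePn[i [j ij e]]].
  rewrite -[image_simplex g _](SubK (osimplex Y q) gs).
  by rewrite chain_mapE simplex_mapE SubK imE.
rewrite raddf0 bracket0 // imE; apply/negP => /forallP/(_ i)/forallP/(_ j).
by rewrite ij ![image_simplex f _ _]ffunE e adj_irr.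
Qed.

Lemma homology_mapE (X Y : digital_image) (f : dmap X Y) q (z : Defs.cycle X q) :
  homology_map f q (\pi_(homology X q) z) = \pi_(homology Y q) (Defs.cycle_map f z).
Proof. exact: quot_liftE. Qed.

Lemma homology_mapK (X Y : digital_image) (f : dmap X Y) (g : dmap Y X) q :
  strongly_homotopic (g \o f) id ->
  cancel (homology_map f q) (homology_map g q).
Proof.
move=> gf h; rewrite -[h]reprK; move: (repr h) => {h} z.
(* Equality of classes becomes the existence of a chain bounding the difference of
   representatives. *)
rewrite (homology_mapE f) (homology_mapE g); apply/eqP; rewrite -Quotient.idealrBE; apply/asboolP.
have c0 : boundary (val z) = 0 by apply/eqP; exact: (valP z).
have := @strongly_homotopic_homologous _ _ (dmap_comp g f) (dmap_id X) gf.
by move/(_ q _ c0) => [b bE]; exists b; rewrite bE chain_map_id chain_map_comp.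
Qed.

Theorem corollary4p5 (X Y : digital_image)
    (finX : finite_set [set: X]%classic)
    (f : dmap X Y) (hf : strong_homotopy_equivalence f) (q : nat) :
  bijective (homology_map f q).
Proof.
have [g [fg gf]] := hf.
(* Each of the two homotopies gives one of the two cancellation laws. *)
by exists (homology_map g q); exact: homology_mapK.
Qed.
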